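(* Let the Smoothness and Boundedness Assumption and the Regularity Assumption hold for Algorithm A (all described in the context), and suppose that there exists $N(\epsilon)\in\{1,2,\dots\}$ such that $\eta_k\le\frac\epsilon2$ for all $k\ge N(\epsilon)$. If, at every outer iteration $k$, the subproblem in step (2) of Algorithm A is solved via the proximal gradient method with stepsize $\alpha_k=1/L_k$, then the total number of proximal gradient iterations required by Algorithm A to return an $\epsilon$-approximate solution, i.e. a pair $(x,y)$ with $\operatorname{dist}(-\nabla_x\mathcal L(x,y),\partial g(x))+\|c(x)\|\le\epsilon$, is $$\widetilde{\mathcal O}(\epsilon^{-3}).$$
   Context: Problem: $\min_{x\in\mathbb R^n} f(x)+g(x)$ subject to $c(x)=0$, where $f:\mathbb R^n\to\mathbb R$ is continuously differentiable (possibly nonconvex), $g:\mathbb R^n\to\mathbb R\cup\{\infty\}$ is convex (possibly nondifferentiable) with subdifferential $\partial g$, and $c:\mathbb R^n\to\mathbb R^m$ is continuously differentiable with Jacobian $J(x)\in\mathbb R^{m\times n}$. $\|\cdot\|$ is the Euclidean norm and $\operatorname{dist}(x,\mathcal X)=\min_{z\in\mathcal X}\|x-z\|$. The Lagrangian is $\mathcal L(x,y)=f(x)+c(x)^Ty$ and the augmented Lagrangian is $\mathcal L_\beta(x,y)=f(x)+c(x)^Ty+\frac\beta2\|c(x)\|^2$. Algorithm A. Inputs: $\epsilon>0$, $\beta_1>0$, $x_1\in\mathbb R^n$, $y_1\in\mathbb R^m$, $y_{\max}>0$, $\gamma>1$, $\tau\in(0,1)$, and a decreasing positive sequence $\{\eta_k'\}_{k\ge1}$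 converging to $0$. For $k=1,2,\dots$: (1) set $\eta_k=\min\{1/\beta_k,\eta_k'\}$; (2) find $x_{k+1}$, an approximate solution of $\min_x\mathcal L_{\beta_k}(x,y_k)+g(x)$, with $\operatorname{dist}(-\nabla_x\mathcal L_{\beta_k}(x_{k+1},y_k),\partial g(x_{k+1}))\le\eta_k$; (3) set $\hat y_{k+1}=y_k+\beta_kc(x_{k+1})$ and quit, returning $(x_{k+1},\hat y_{k+1})$, if $\operatorname{dist}(-\nabla_x\mathcal L(x_{k+1},\hat y_{k+1}),\partial g(x_{k+1}))+\|c(x_{k+1})\|\le\epsilon$; (4) if $\|c(x_{k+1})\|\le\tau\|c(x_k)\|$ set $\beta_{k+1}=\beta_k$, otherwise $\beta_{k+1}=\gamma\beta_k$; (5) set $y_{k+1}$ to be the componentwise projection of $\hat y_{k+1}$ onto $[-y_{\max},y_{\max}]$. Smoothness and Boundedness Assumption: there exist $L_f,L_J,L_c\ge0$ with $\|\nabla f(x)-\nabla f(v)\|\le L_f\|x-v\|$, $\|J(x)-J(v)\|\le L_J\|x-v\|$, $\|c(x)-c(v)\|\le L_c\|x-v\|$ for all $x,v\in\mathbb R^n$; there exist $\lambda_f',\lambda_J'\ge0$ with $\|\nabla f(x)\|\le\lambda_f'$, $\|J(x)\|\le\lambda_J'$ for all $x$; and $f,g$ are bounded below by $f_{\min},g_{\min}$. Regularity Assumption: there is $\nu>0$ such that for all iterates $k$ of Algorithm A, $\nu\|c(x_{k+1})\|\le\operatorname{dist}\big(-J(x_{k+1})^Tc(x_{k+1}),\ \partial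 g(x_{k+1})/\beta_k\big)$. Constants: $\bar y_{\max}=\sup_{k\ge1}\|y_k\|_2$; $c_{\mathrm{big}}=\max\{\|c(x_1)\|,\ (\lambda_f'+\lambda_J'\bar y_{\max}+\frac1{\beta_1})/(\nu\beta_1)\}$; $L_k$ denotes the Lipschitz parameter of $x\mapsto\nabla_x\mathcal L_{\beta_k}(x,y_k)$, given by $L_k=L_f+\bar y_{\max}L_J+\beta_kL_Jc_{\mathrm{big}}+\beta_k\lambda_J'L_c$. Proximal gradient method for the $k$-th subproblem: started from $x_k$, it iterates $x\mapsto\operatorname{prox}_{\alpha_kg}(x-\alpha_k\nabla_x\mathcal L_{\beta_k}(x,y_k))$, where $\operatorname{prox}_{\alpha g}(x)=\arg\min_u\{g(u)+\frac1{2\alpha}\|u-x\|^2\}$, until the criterion in step (2) is met. The notation $\widetilde{\mathcal O}$ suppresses factors logarithmic in $\epsilon^{-1}$.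
   Formalization: The claim fails when η'_k decays too fast; added: for a fixed κ>0, on which the hidden constant may depend, η'_k ≥ κε at every outer iteration executed. Also g is finite somewhere, and L_k>0 is taken to be a Lipschitz parameter as in the context. *)

(* Defs.v *)
From HB Require Import structures.
From mathcomp Require Import all_boot all_order all_algebra.
From mathcomp Require Import all_classical all_reals all_analysis.

Set Implicit Arguments.
Unset Strict Implicit.
Unset Printing Implicit Defensive.

Import Order.TTheory GRing.Theory Num.Theory.
Import numFieldNormedType.Exports.

Local Open Scope classical_set_scope.
Local Open Scope ring_scope.

(* Vectors are rows, following [jacobian]: the matrix-vector product A v is
   [v *m A^T], and J(x)^T y is [y *m Jac c x]. *)

Definition dot (R : realType) (n : nat) (u v : 'rV[R]_n) : R :=
  \sum_i u 0 i * v 0 i.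

(* The norm [`|u|] of the library on matrices is the max norm, hence: *)
Definition enorm (R : realType) (n : nat) (u : 'rV[R]_n) : R :=
  Num.sqrt (dot u u).

(* Operator norm induced by the Euclidean norms. *)
Definition opnorm (R : realType) (m n : nat) (A : 'M[R]_(m, n)) : R :=
  sup [set enorm (v *m A^T) | v in [set v : 'rV[R]_n | enorm v <= 1]].

(* Equal to +oo when X is empty (e.g. a subdifferential outside the domain). *)
Definition dist_to (R : realType) (n : nat) (x : 'rV[R]_n)
    (X : set 'rV[R]_n) : \bar R :=
  ereal_inf [set (enorm (x - z))%:E | z in X].

Definition grad (R : realType) (n : nat) (f : 'rV[R]_n -> R) (x : 'rV[R]_n) :
    'rV[R]_n :=
  \row_j 'D_(delta_mx 0 j) f x.

(* The library's [jacobian] acts on rows from the right, so the usual m x n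
   matrix of partial derivatives is its transpose. *)
Definition Jac (R : realType) (n m : nat) (c : 'rV[R]_n -> 'rV[R]_m)
    (x : 'rV[R]_n) : 'M[R]_(m, n) :=
  (jacobian c x)^T.

Definition subdiff (R : realType) (n : nat) (g : 'rV[R]_n -> \bar R)
    (x : 'rV[R]_n) : set 'rV[R]_n :=
  [set v | (g x < +oo)%E /\
           forall u, (g x + (dot v (u - x)%R)%:E <= g u)%E].

Definition econvex (R : realType) (n : nat) (g : 'rV[R]_n -> \bar R) : Prop :=
  forall (x v : 'rV[R]_n) (t : R), 0 <= t <= 1 ->
    (g (t *: x + (1 - t) *: v)%R <= t%:E * g x + (1 - t)%R%:E * g v)%E.

Definition is_prox (R : realType) (n : nat) (alpha : R)
    (g : 'rV[R]_n -> \bar R) (x u : 'rV[R]_n) : Prop :=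
  forall w, (g u + ((2 * alpha)^-1 * enorm (u - x) ^+ 2)%R%:E <=
             g w + ((2 * alpha)^-1 * enorm (w - x) ^+ 2)%R%:E)%E.

Definition elipschitz (R : realType) (n m : nat) (L : R)
    (F : 'rV[R]_n -> 'rV[R]_m) : Prop :=
  forall x v, enorm (F x - F v) <= L * enorm (x - v).

(* minimize f(x) + g(x) subject to c(x) = 0 *)
Record problem (R : realType) (n m : nat) := Problem {
  pf : 'rV[R]_n -> R;
  pg : 'rV[R]_n -> \bar R;
  pc : 'rV[R]_n -> 'rV[R]_m }.

Definition lagrangian (R : realType) (n m : nat) (P : problem R n m)
    (y : 'rV[R]_m) (x : 'rV[R]_n) : R :=
  pf P x + dot (pc P x) y.

Definition aug_lagrangian (R : realType) (n m : nat) (P : problem R n m)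
    (beta : R) (y : 'rV[R]_m) (x : 'rV[R]_n) : R :=
  pf P x + dot (pc P x) y + beta / 2 * enorm (pc P x) ^+ 2.

Definition eps_approximate (R : realType) (n m : nat) (P : problem R n m)
    (eps : R) (x : 'rV[R]_n) (y : 'rV[R]_m) : Prop :=
  (dist_to (- grad (lagrangian P y) x)%R (subdiff (pg P) x)
     + (enorm (pc P x))%:E <= eps%:E)%E.

(* Lf, LJ, Lc: Lipschitz constants of grad f, J, c; lamf, lamJ: bounds on
   |grad f|, |J|; fmin, gmin: lower bounds of f, g; nu: regularity. *)
Record constants (R : realType) := Constants {
  Lf : R; LJ : R; Lc : R; lamf : R; lamJ : R; fmin : R; gmin : R; nu : R }.

(* g is proper and takes values in R u {+oo}: -oo is excluded by gmin. *)
Definition standing_problem (R : realType) (n m : nat) (P : problem R n m) :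
    Prop :=
  [/\ (forall x, differentiable (pf P) x) /\ continuous (grad (pf P)),
      (forall x, differentiable (pc P) x) /\ continuous (Jac (pc P)),
      econvex (pg P),
      (forall x, (-oo < pg P x)%E) &
      (exists x, (pg P x < +oo)%E)].

Definition smooth_bounded (R : realType) (n m : nat) (P : problem R n m)
    (K : constants R) : Prop :=
  [/\ [/\ 0 <= Lf K, 0 <= LJ K, 0 <= Lc K, 0 <= lamf K & 0 <= lamJ K],
      [/\ elipschitz (Lf K) (grad (pf P)),
          (forall x v, opnorm (Jac (pc P) x - Jac (pc P) v)
                         <= LJ K * enorm (x - v)) &
          elipschitz (Lc K) (pc P)],
      (forall x, enorm (grad (pf P) x) <= lamf K) /\
      (forall x, opnorm (Jac (pc P) x) <= lamJ K) &
      (forall x, fmin K <= pf P x) /\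
      (forall x, ((gmin K)%:E <= pg P x)%E)].

(* The inputs of the algorithm other than eps and (eta'_k). *)
Record inputs (R : realType) (n m : nat) := Inputs {
  beta1 : R; x1 : 'rV[R]_n; y1 : 'rV[R]_m; ymax : R; gam : R; tau : R }.

Definition valid_inputs (R : realType) (n m : nat) (I : inputs R n m) : Prop :=
  [/\ 0 < beta1 I, 0 < ymax I, 1 < gam I & 0 < tau I < 1].

(* Sequences of the algorithm are indexed from 1; values at 0 are unused. *)
Definition tolerance_sequence (R : realType) (eta' : nat -> R) : Prop :=
  [/\ (forall k, (1 <= k)%N -> 0 < eta' k),
      (forall k, (1 <= k)%N -> eta' k.+1 <= eta' k) &
      eta' k @[k --> \oo] --> (0 : R)].

(* [inner r k t] is the t-th proximal gradient iterate of the k-th subproblem.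
   Only the values actually computed by the algorithm are constrained by
   [is_run] below. *)
Record trace (R : realType) (n m : nat) := Trace {
  outer : nat -> 'rV[R]_n;
  mult : nat -> 'rV[R]_m;
  pen : nat -> R;
  inner : nat -> nat -> 'rV[R]_n }.

Definition tol (R : realType) (n m : nat) (eta' : nat -> R)
    (r : trace R n m) (k : nat) : R :=
  Num.min (1 / pen r k) (eta' k).

(* The multiplier estimate produced at iteration k, i.e. hat y_{k+1}. *)
Definition yhat (R : realType) (n m : nat) (P : problem R n m)
    (r : trace R n m) (k : nat) : 'rV[R]_m :=
  mult r k + pen r k *: pc P (outer r k.+1).

Definition inner_stop (R : realType) (n m : nat) (P : problem R n m)
    (eta' : nat -> R) (r : trace R n m) (k : nat) (u : 'rV[R]_n) : Prop :=
  (dist_to (- grad (aug_lagrangian P (pen r k) (mult r k)) u)%R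
           (subdiff (pg P) u) <= (tol eta' r k)%:E)%E.

(* The k-th subproblem is solved after exactly t proximal gradient iterations. *)
Definition inner_iters (R : realType) (n m : nat) (P : problem R n m)
    (eta' : nat -> R) (r : trace R n m) (k t : nat) : Prop :=
  inner_stop P eta' r k (inner r k t) /\
  forall s, (s < t)%N -> ~ inner_stop P eta' r k (inner r k s).

Definition quits (R : realType) (n m : nat) (P : problem R n m) (eps : R)
    (r : trace R n m) (k : nat) : Prop :=
  eps_approximate P eps (outer r k.+1) (yhat P r k).

(* Outer iteration k is started: all previous subproblem solves terminated and
   the algorithm has not quit. *)
Definition executed (R : realType) (n m : nat) (P : problem R n m) (eps : R)
    (eta' : nat -> R) (r : trace R n m) (k : nat) : Prop :=
  (1 <= k)%N /\
  forall j, (1 <= j < k)%N ->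
    (exists t, inner_iters P eta' r j t) /\ ~ quits P eps r j.

Definition ybar (R : realType) (n m : nat) (P : problem R n m) (eps : R)
    (eta' : nat -> R) (r : trace R n m) : R :=
  sup [set enorm (mult r k) | k in [set k | executed P eps eta' r k]].

Definition cbig (R : realType) (n m : nat) (P : problem R n m)
    (K : constants R) (I : inputs R n m) (eps : R) (eta' : nat -> R)
    (r : trace R n m) : R :=
  Num.max (enorm (pc P (x1 I)))
    ((lamf K + lamJ K * ybar P eps eta' r + 1 / beta1 I) / (nu K * beta1 I)).

Definition Lk (R : realType) (n m : nat) (P : problem R n m)
    (K : constants R) (I : inputs R n m) (eps : R) (eta' : nat -> R)
    (r : trace R n m) (k : nat) : R :=
  Lf K + ybar P eps eta' r * LJ K
    + pen r k * LJ K * cbig P K I eps eta' r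
    + pen r k * lamJ K * Lc K.

Definition box_proj (R : realType) (m : nat) (b : R) (y : 'rV[R]_m) :
    'rV[R]_m :=
  \row_i Num.max (- b) (Num.min b (y 0 i)).

(* r is the trace of the algorithm whose subproblems are solved by the proximal
   gradient method with stepsize 1 / L_k; neither loop is assumed to
   terminate. *)
Definition is_run (R : realType) (n m : nat) (P : problem R n m)
    (K : constants R) (I : inputs R n m) (eps : R) (eta' : nat -> R)
    (r : trace R n m) : Prop :=
  [/\ outer r 1%N = x1 I, mult r 1%N = y1 I, pen r 1%N = beta1 I,
      (forall k, executed P eps eta' r k ->
         [/\ inner r k 0%N = outer r k,
             (forall t,
                (forall s, (s <= t)%N -> ~ inner_stop P eta' r k (inner r k s)) ->
                is_prox (1 / Lk P K I eps eta' r k) (pg P)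
                  (inner r k t - (1 / Lk P K I eps eta' r k) *:
                     grad (aug_lagrangian P (pen r k) (mult r k)) (inner r k t))
                  (inner r k t.+1)) &
             (forall t, inner_iters P eta' r k t ->
                outer r k.+1 = inner r k t)]) &
      (forall k, (1 <= k)%N -> executed P eps eta' r k.+1 ->
         pen r k.+1 = (if enorm (pc P (outer r k.+1))
                            <= tau I * enorm (pc P (outer r k))
                       then pen r k else gam I * pen r k) /\
         mult r k.+1 = box_proj (ymax I) (yhat P r k))].

Definition regularity (R : realType) (n m : nat) (P : problem R n m)
    (K : constants R) (eps : R) (eta' : nat -> R) (r : trace R n m) : Prop :=
  forall k, executed P eps eta' r k -> (exists t, inner_iters P eta' r k t) ->
    let x := outer r k.+1 in
    ((nu K * enorm (pc P x))%R%:E <=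
     dist_to (- (pc P x *m Jac (pc P) x))%R
             [set (pen r k)^-1 *: v | v in subdiff (pg P) x]%R)%E.

(* L_k is a (positive, so that the stepsize 1 / L_k makes sense) Lipschitz
   constant of the gradient of the k-th augmented Lagrangian. *)
Definition Lk_lipschitz (R : realType) (n m : nat) (P : problem R n m)
    (K : constants R) (I : inputs R n m) (eps : R) (eta' : nat -> R)
    (r : trace R n m) : Prop :=
  forall k, executed P eps eta' r k ->
    0 < Lk P K I eps eta' r k /\
    elipschitz (Lk P K I eps eta' r k)
      (grad (aug_lagrangian P (pen r k) (mult r k))).

(* Main.v *)
Require Import Defs.
From mathcomp Require Import all_boot all_order all_algebra.
From mathcomp Require Import all_classical all_reals all_analysis.
From mathcomp Require Import ring lra.

Set Implicit Arguments.
Unset Strict Implicit.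
Unset Printing Implicit Defensive.

Import Order.TTheory GRing.Theory Num.Theory.
Import numFieldNormedType.Exports.

Local Open Scope ring_scope.

(** The theorem holds because one potential decreases along the whole run, over
    inner and outer iterations together.

    A proximal gradient step with stepsize 1 / L from x to u decreases the
    objective F = phi + g of the subproblem by at least L / 2 |u - x|^2, and
    -grad phi (u) lies within 2 L |u - x| of the subdifferential of g at u
    ([pg_step_decrease], [pg_step_stationarity]).  So a step whose endpoint is
    not theta-stationary costs F at least theta^2 / (8 L) ([pg_step_charge]).
    Along a run, theta can be taken proportional to eps and L_k = O(1 / eps),
    whence a decrease of order eps^3 per step; this is the source of the
    exponent 3.

    These two rates rest on a bound on the penalty parameter.  The regularity
    condition, the stopping test and the bounded multipliers give
    |c(x_(k+1))| <= D / beta_k ([residual_le]), and the tolerance is at most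
    1 / beta_k; once beta_k exceeds a multiple of 1 / eps the algorithm therefore
    quits, so beta_k = O(1 / eps) throughout ([pen_le]).

    It remains to bound the total decrease available.  The last step of a
    subproblem may reach its tolerance with an arbitrarily small decrease.  But
    if the algorithm does not quit there, either the endpoint is not
    eps / 2-stationary, and the step is charged as above, or
    |c(x_(k+1))| > eps / 2, and its cost of order eps^3 is at most a multiple of
    |c(x_(k+1))| ([solve_nonquit]).  Passing to the next subproblem changes the
    multiplier, which raises the objective by at most a multiple of
    |c(x_(k+1))|, and possibly the penalty, which raises it by at most a
    constant ([merit_next]).  Finally |c(x_(k+1))| is itself controlled: if the
    penalty is kept, |c| contracts by the factor tau, and if it is raised,
    the level ln beta_k / ln gamma goes up by one ([residual_contract]).  Hence
    [potential], a combination of the current objective, the current |c| and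
    minus the level, decreases by the cost of the steps at every outer iteration,
    however many outer iterations there are.  The objective is bounded below
    and the level is O(1 + ln (1 / eps)), so the total number of steps is
    O(eps^(-3) (1 + ln (1 / eps))).

    The same estimates give termination: the inner loop stops because the
    objective is bounded below ([inner_terminates]), and the outer loop because
    the sum of the |c(x_(k+1))| is bounded, while each of them exceeds eps / 2
    if the algorithm goes on after the tolerances are below eps / 2
    ([outer_terminates]). *)

(** * Euclidean norm and operator norm *)

Section Euclidean.
Context {R : realType}.

Lemma dotC n (u v : 'rV[R]_n) : dot u v = dot v u.
Proof. by apply: eq_bigr => i _; rewrite mulrC. Qed.

Lemma dotDl n (u v w : 'rV[R]_n) : dot (u + v) w = dot u w + dot v w.
Proof. by rewrite /dot -big_split; apply: eq_bigr => i _; rewrite mxE mulrDl. Qed.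

Lemma dotDr n (u v w : 'rV[R]_n) : dot w (u + v) = dot w u + dot w v.
Proof. by rewrite dotC dotDl !(dotC w). Qed.

Lemma dotZl n a (u v : 'rV[R]_n) : dot (a *: u) v = a * dot u v.
Proof. by rewrite /dot mulr_sumr; apply: eq_bigr => i _; rewrite mxE mulrA. Qed.

Lemma dotZr n a (u v : 'rV[R]_n) : dot v (a *: u) = a * dot v u.
Proof. by rewrite dotC dotZl dotC. Qed.

Lemma dotNl n (u v : 'rV[R]_n) : dot (- u) v = - dot u v.
Proof. by rewrite -scaleN1r dotZl mulN1r. Qed.

Lemma dotNr n (u v : 'rV[R]_n) : dot v (- u) = - dot v u.
Proof. by rewrite dotC dotNl dotC. Qed.

Definition dotE := (@dotDl, @dotDr, @dotNl, @dotNr, @dotZl, @dotZr).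

Lemma dot_ge0 n (u : 'rV[R]_n) : 0 <= dot u u.
Proof. by apply: sumr_ge0 => i _; rewrite -expr2 sqr_ge0. Qed.

Lemma enorm_ge0 n (u : 'rV[R]_n) : 0 <= enorm u.
Proof. exact: sqrtr_ge0. Qed.

Lemma enorm_sqr n (u : 'rV[R]_n) : enorm u ^+ 2 = dot u u.
Proof. by rewrite sqr_sqrtr// dot_ge0. Qed.

Lemma enorm0 n : enorm (0 : 'rV[R]_n) = 0.
Proof. by rewrite /enorm /dot big1 ?sqrtr0// => i _; rewrite mxE mul0r. Qed.

Lemma enorm0_eq0 n (u : 'rV[R]_n) : enorm u = 0 -> u = 0.
Proof.
move=> u0; have /eqP := enorm_sqr u; rewrite u0 expr0n eq_sym.
rewrite psumr_eq0 => [/allP h|i _]; last by rewrite -expr2 sqr_ge0.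
apply/rowP => i; have := h i (mem_index_enum i).
by rewrite -expr2 sqrf_eq0 mxE => /eqP.
Qed.

Lemma enormZ n a (u : 'rV[R]_n) : enorm (a *: u) = `|a| * enorm u.
Proof. by rewrite /enorm !dotE mulrA -expr2 sqrtrM ?sqr_ge0// sqrtr_sqr. Qed.

Lemma enormN n (u : 'rV[R]_n) : enorm (- u) = enorm u.
Proof. by rewrite /enorm !dotE opprK. Qed.

Lemma enormBC n (u v : 'rV[R]_n) : enorm (u - v) = enorm (v - u).
Proof. by rewrite -enormN opprB. Qed.

Lemma cauchy_schwarz n (u v : 'rV[R]_n) : dot u v <= enorm u * enorm v.
Proof.
have [/enorm0_eq0->|u0] := eqVneq (enorm u) 0.
  by rewrite enorm0 mul0r /dot big1// => i _; rewrite mxE mul0r.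
have [/enorm0_eq0->|v0] := eqVneq (enorm v) 0.
  by rewrite enorm0 mulr0 /dot big1// => i _; rewrite mxE mulr0.
have ab : 0 < enorm u * enorm v.
  by rewrite mulr_gt0// lt_neqAle enorm_ge0 eq_sym (u0, v0).
have := dot_ge0 (enorm v *: u - enorm u *: v).
rewrite !dotE -!enorm_sqr (dotC v u) => h; rewrite -(ler_pM2l ab); nra.
Qed.

Lemma enormD n (u v : 'rV[R]_n) : enorm (u + v) <= enorm u + enorm v.
Proof.
rewrite -(@ler_pXn2r _ 2)// ?nnegrE ?addr_ge0 ?enorm_ge0//.
rewrite enorm_sqr !dotE (dotC v u) -!enorm_sqr.
have := cauchy_schwarz u v; nra.
Qed.

Lemma enormB n (u v : 'rV[R]_n) : enorm (u - v) <= enorm u + enorm v.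
Proof. by rewrite -(enormN v) enormD. Qed.

(** The set whose supremum defines [opnorm] is bounded, by the Frobenius norm, so
    that [opnorm] is a genuine bound and not the default value of [sup]. *)
Lemma enorm_mulmx_le_opnorm m n (A : 'M[R]_(m, n)) (v : 'rV[R]_n) :
  enorm (v *m A^T) <= opnorm A * enorm v.
Proof.
pose C := \sum_i enorm (row i A) ^+ 2.
have bnd (w : 'rV[R]_n) : enorm w <= 1 -> enorm (w *m A^T) <= Num.sqrt C.
  move=> w1; rewrite ler_sqrt; last by apply: sumr_ge0 => i _; rewrite sqr_ge0.
  apply: ler_sum => i _; have -> : (w *m A^T) 0 i = dot w (row i A).
    by rewrite mxE; apply: eq_bigr => j _; rewrite !mxE.
  have := cauchy_schwarz w (row i A); have := cauchy_schwarz (- w) (row i A).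
  rewrite dotNl enormN => h1 h2.
  have := enorm_ge0 w; have := enorm_ge0 (row i A).
  have : enorm w * enorm (row i A) <= enorm (row i A).
    by rewrite ler_piMl ?enorm_ge0.
  by move=> *; nra.
have ub : has_ubound
    [set enorm (w *m A^T) | w in [set w : 'rV[R]_n | enorm w <= 1]]%classic.
  by exists (Num.sqrt C) => _ [w /= w1 <-]; exact: bnd.
have [/enorm0_eq0->|v0] := eqVneq (enorm v) 0; first by rewrite mul0mx !enorm0 mulr0.
have vp : 0 < enorm v by rewrite lt_neqAle enorm_ge0 eq_sym v0.
rewrite -ler_pdivrMr//; apply: ub_le_sup => //.
exists ((enorm v)^-1 *: v) => /=; last first.
  by rewrite -scalemxAl enormZ ger0_norm ?invr_ge0 ?enorm_ge0// mulrC.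
by rewrite enormZ ger0_norm ?invr_ge0 ?enorm_ge0// mulVf.
Qed.

Lemma dot_mulmx_tr m n (A : 'M[R]_(m, n)) (y : 'rV[R]_m) (v : 'rV[R]_n) :
  dot (y *m A) v = dot y (v *m A^T).
Proof.
have dotM k (a b : 'rV[R]_k) : dot a b = (a *m b^T) 0 0.
  by rewrite mxE; apply: eq_bigr => i _; rewrite mxE.
by rewrite !dotM trmx_mul trmxK mulmxA.
Qed.

Lemma opnorm_ge0 m n (A : 'M[R]_(m, n)) : 0 <= opnorm A.
Proof.
have [ub|nub] := pselect (has_sup
  [set enorm (w *m A^T) | w in [set w : 'rV[R]_n | enorm w <= 1]]%classic);
  last first.
  by rewrite /opnorm sup_out.
apply: le_trans (enorm_ge0 (0 *m A^T)) _; apply: ub_le_sup; first exact: ub.2.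
by exists 0; rewrite //= enorm0.
Qed.

(** A matrix and its transpose have the same operator norm: |y A|^2 =
    <y, (y A) A^T>, to which Cauchy-Schwarz applies. *)
Lemma enorm_mulmx_tr_le_opnorm m n (A : 'M[R]_(m, n)) (y : 'rV[R]_m) :
  enorm (y *m A) <= opnorm A * enorm y.
Proof.
have [->|w0] := eqVneq (enorm (y *m A)) 0.
  by rewrite mulr_ge0 ?enorm_ge0 ?opnorm_ge0.
have wp : 0 < enorm (y *m A) by rewrite lt_neqAle enorm_ge0 eq_sym w0.
rewrite -(ler_pM2r wp) -expr2 enorm_sqr dot_mulmx_tr.
apply: le_trans (cauchy_schwarz _ _) _.
rewrite mulrAC mulrC ler_wpM2r ?enorm_ge0//.
exact: enorm_mulmx_le_opnorm.
Qed.

End Euclidean.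

(** * Gradients and the descent lemma *)

Section Calculus.
Context {R : realType} {n : nat}.
Implicit Types (phi : 'rV[R]_n -> R) (x d : 'rV[R]_n).

Lemma dot_delta (w : 'rV[R]_n) j : dot w (delta_mx 0 j) = w 0 j.
Proof.
rewrite /dot (bigD1 j)//= big1 => [|i ij]; rewrite !mxE !eqxx ?mulr1 ?addr0//.
by rewrite (negPf ij) mulr0.
Qed.

Lemma derive_grad phi x d : differentiable phi x ->
  'D_d phi x = dot (grad phi x) d.
Proof.
move=> dphi; rewrite deriveE// [in LHS](row_sum_delta d) linear_sum.
apply: eq_bigr => j _ /=; rewrite linearZ mxE deriveE//= mulrC//.
Qed.

Lemma gradP phi x (w : 'rV[R]_n) :
  (forall d, 'D_d phi x = dot w d) -> grad phi x = w.
Proof. by move=> h; apply/rowP => j; rewrite mxE h dot_delta. Qed.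

Lemma is_derive_line phi x d (t : R) : differentiable phi (x + t *: d) ->
  is_derive t 1 (fun s => phi (x + s *: d)) (dot (grad phi (x + t *: d)) d).
Proof.
move=> dphi; rewrite -derive_grad//.
have E : (fun h : R => h^-1 *: (((fun s => phi (x + s *: d)) \o shift t) (h *: 1) -
                        phi (x + t *: d))) =
   (fun h : R => h^-1 *: ((phi \o shift (x + t *: d)) (h *: d) - phi (x + t *: d))).
  apply/funext => h /=; congr (_ *: (phi _ - _)).
  by rewrite /shift /= [h *: 1]mulr1 scalerDl addrCA.
split; first by rewrite /derivable E; exact: diff_derivable.
by rewrite /derive E.
Qed.

(** The function psi below, the error of the quadratic upper model along the
    segment from x to u, has a nonpositive derivative by the Lipschitz bound. *)
Lemma descent_lemma phi L x u :
  (forall z, differentiable phi z) -> elipschitz L (grad phi) ->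
  phi u <= phi x + dot (grad phi x) (u - x) + L / 2 * enorm (u - x) ^+ 2.
Proof.
move=> dphi lip; set d := u - x.
pose psi (t : R) : R := phi (x + t *: d) - t * dot (grad phi x) d
              - (L / 2 * enorm d ^+ 2) * t ^+ 2.
pose dpsi (t : R) : R := dot (grad phi (x + t *: d)) d - dot (grad phi x) d
              - (L * enorm d ^+ 2) * t.
have dpsiE (t : R) : is_derive t (1 : R) psi (dpsi t).
  have h := is_derive_line (dphi (x + t *: d)).
  rewrite /psi; apply: is_derive_eq; rewrite /dpsi.
  rewrite scaler0 add0r /GRing.scale/=; by field.
have cpsi : {within `[0, 1], continuous psi}%classic.
  by apply: derivable_within_continuous => s _; have [] := dpsiE s.
have [t t01 E] := MVT ltr01 (fun s _ => dpsiE s) cpsi.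
suff : dpsi t <= 0.
  move: E; rewrite /psi subr0 mulr1 => <-.
  rewrite scale0r scale1r addr0 /d subrKC !mul0r expr0n/= mulr0 expr1n.
  lra.
move: t01; rewrite in_itv/= => /andP[t0 _].
rewrite /dpsi subr_le0 -dotNl -dotDl.
apply: le_trans (cauchy_schwarz _ _) _.
have := lip (x + t *: d) x; rewrite [x + _]addrC addrK enormZ (ger0_norm (ltW t0)).
move=> /(ler_wpM2r (enorm_ge0 d)) h.
by apply: (le_trans h); rewrite le_eqVlt; apply/orP; left; apply/eqP; ring.
Qed.

End Calculus.

Section Lagrangian.
Context {R : realType} {n m : nat} (P : problem R n m).
Hypothesis dpf : forall x, differentiable (pf P) x.
Hypothesis dpc : forall x, differentiable (pc P) x.

Let coord i (x : 'rV[R]_n) : R := pc P x 0 i.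

Let dcoord i x : differentiable (coord i) x.
Proof.
by apply: (@differentiable_comp _ _ _ _ (pc P) (fun N : 'rV[R]_m => N 0 i : R));
  [|exact: differentiable_coord].
Qed.

Let derive_coord i x d : 'D_d (coord i) x = 'D_d (pc P) x 0 i.
Proof. by rewrite derive_mx ?mxE//; exact: diff_derivable. Qed.

Let augE beta y : aug_lagrangian P beta y =
  (pf P + \sum_i (y 0 i \*: coord i + (beta / 2) \*: (coord i * coord i)))%R.
Proof.
apply/funext => x; rewrite /aug_lagrangian enorm_sqr /dot.
rewrite -addrA mulr_sumr -big_split /=.
rewrite fctE fct_sumE; congr (_ + _); apply: eq_bigr => i _.
by rewrite mulrC.
Qed.

Lemma differentiable_aug_lagrangian beta y x :
  differentiable (aug_lagrangian P beta y) x.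
Proof.
rewrite augE; apply: differentiableD => //; apply: differentiable_sum => i.
apply: differentiableD; first exact: differentiableZ.
by apply: differentiableZ; exact: differentiableM.
Qed.

Lemma grad_aug_lagrangian beta y x :
  grad (aug_lagrangian P beta y) x =
  grad (pf P) x + (y + beta *: pc P x) *m Jac (pc P) x.
Proof.
have dv d i : derivable (coord i) x d by exact: diff_derivable.
apply: gradP => d; rewrite augE deriveD; first last.
- apply: derivable_sum => i; apply: derivableD; first exact: derivableZ.
  by apply: derivableZ; exact: derivableM.
- exact: diff_derivable.
rewrite derive_sum => [|i]; last first.
  apply: derivableD; first exact: derivableZ.
  by apply: derivableZ; exact: derivableM.
rewrite dotDl derive_grad// dot_mulmx_tr /Jac trmxK -deriveEjacobian//.
congr (_ + _); apply: eq_bigr => i _.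
rewrite deriveD; [|exact: derivableZ|by apply: derivableZ; exact: derivableM].
rewrite !deriveZ//; last exact: derivableM.
by rewrite deriveM// derive_coord !mxE /coord /GRing.scale/=; field.
Qed.

Lemma grad_lagrangian y x :
  grad (lagrangian P y) x = grad (pf P) x + y *m Jac (pc P) x.
Proof.
have -> : lagrangian P y = aug_lagrangian P 0 y.
  by apply/funext => z; rewrite /aug_lagrangian !mul0r addr0.
by rewrite grad_aug_lagrangian scale0r addr0.
Qed.

End Lagrangian.

(** * Proximal gradient steps *)

Section Prox.
Context {R : realType} {n : nat} (g : 'rV[R]_n -> \bar R).
Hypothesis gconv : econvex g.
Hypothesis gproper : forall x, (-oo < g x)%E.

Let gfin x : (g x < +oo)%E -> exists r, g x = r%:E.
Proof. by have := gproper x; case: (g x) => // r _ _; exists r. Qed.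

Lemma prox_dom (alpha : R) (z u w : 'rV[R]_n) :
  is_prox alpha g z u -> (g w < +oo)%E -> (g u < +oo)%E.
Proof.
move=> /(_ w) + /gfin[r gw]; rewrite gw -EFinD.
by have := gproper u; case: (g u).
Qed.

(** First-order optimality of the proximal point: compare u with the points
    t w + (1 - t) u, where convexity bounds g, then let t tend to 0. *)
Lemma prox_variational (alpha : R) (z u w : 'rV[R]_n) :
  0 < alpha -> is_prox alpha g z u -> (g w < +oo)%E ->
  fine (g u) + alpha^-1 * dot (z - u) (w - u) <= fine (g w).
Proof.
move=> a0 pu gw; have gu := prox_dom pu gw.
have [rw gwE] := gfin gw; have [ru guE] := gfin gu.
rewrite gwE guE /=; set d := w - u.
apply/ler_addgt0Pr => e e0.
have key (t : R) : 0 < t -> t <= 1 ->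
    ru + alpha^-1 * dot (z - u) d <= rw + t * ((2 * alpha)^-1 * enorm d ^+ 2).
  move=> t0 t1; pose v := t *: w + (1 - t) *: u.
  have gv : (g v <= (t * rw + (1 - t) * ru)%:E)%E.
    have t01 : 0 <= t <= 1 by rewrite (ltW t0).
    by apply: le_trans (gconv w u t01) _; rewrite gwE guE -!EFinM -EFinD.
  have := pu v; rewrite guE.
  have -> : v - z = (u - z) + t *: d.
    by apply/rowP => i; rewrite !mxE; ring.
  move=> /le_trans/(_ (leeD gv (lexx _))); rewrite -!EFinD lee_fin.
  rewrite -(opprB u z); move: (u - z) d {v gv} => a {}d.
  rewrite !enorm_sqr !dotE (dotC d a).
  have -> : (2 * alpha)^-1 = alpha^-1 / 2 by rewrite invfM mulrC.
  have ia0 : 0 < alpha^-1 by rewrite invr_gt0.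
  by move=> h; rewrite -(ler_pM2l t0); nra.
have [d0|d0] := eqVneq d 0.
  have := key 1 ltr01 (lexx _); rewrite d0 enorm0 expr0n/= !mulr0 => h; lra.
have N0 : 0 < (2 * alpha)^-1 * enorm d ^+ 2.
  apply: mulr_gt0; first by rewrite invr_gt0 mulr_gt0.
  rewrite exprn_gt0// lt_neqAle enorm_ge0 andbT.
  by apply: contra_neq d0 => /esym/enorm0_eq0.
set N := (2 * alpha)^-1 * enorm d ^+ 2 in key N0.
(* This t makes the error term of [key] at most e. *)
have t0 : 0 < Num.min 1 (e / N) by rewrite lt_min ltr01 divr_gt0.
apply: le_trans (key _ t0 _) _; first by rewrite ge_min lexx.
by rewrite lerD2l -ler_pdivlMr// ge_min lexx orbT.
Qed.

Lemma prox_subdiff (alpha : R) (z u : 'rV[R]_n) :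
  0 < alpha -> is_prox alpha g z u -> (g u < +oo)%E ->
  subdiff g u (alpha^-1 *: (z - u)).
Proof.
move=> a0 pu gu; split=> // w.
have [gw|] := ltP (g w) +oo%E; last by rewrite leye_eq => /eqP->; rewrite leey.
have := prox_variational a0 pu gw.
have [rw ->] := gfin gw; have [ru ->] := gfin gu.
by rewrite dotZl -EFinD lee_fin.
Qed.

Lemma dist_to_le (x z : 'rV[R]_n) (X : set 'rV[R]_n) :
  X z -> (dist_to x X <= (enorm (x - z))%:E)%E.
Proof. by move=> Xz; apply: ge_ereal_inf; exists (enorm (x - z))%:E => //; exists z. Qed.

Section Step.
Variables (phi : 'rV[R]_n -> R) (L : R).
Hypothesis dphi : forall x, differentiable phi x.
Hypothesis L0 : 0 < L.
Hypothesis lipphi : elipschitz L (grad phi).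

Definition pg_step (x u : 'rV[R]_n) :=
  is_prox (1 / L) g (x - (1 / L) *: grad phi x) u.

Let F (x : 'rV[R]_n) : R := phi x + fine (g x).

Let iL0 : 0 < 1 / L. Proof. by rewrite divr_gt0. Qed.

(** Adds the descent lemma to the variational inequality of the proximal point.
    The competitor w is arbitrary: w = x gives the decrease of F, and a fixed w
    bounds F after a step from a point x where g is infinite. *)
Lemma pg_step_le x u w : pg_step x u -> (g w < +oo)%E ->
  F u <= phi x + fine (g w) + dot (grad phi x) (w - x)
         + L * dot (u - x) (w - x) - L / 2 * enorm (u - x) ^+ 2.
Proof.
move=> pu gw; have := prox_variational iL0 pu gw.
have := descent_lemma x u dphi lipphi; rewrite /F !div1r invrK.
have -> : x - L^-1 *: grad phi x - u = - (u - x) - L^-1 *: grad phi x.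
  by apply/rowP => i; rewrite !mxE; ring.
have -> : w - u = (w - x) - (u - x) by rewrite opprB addrA subrK.
have E (d e v : 'rV[R]_n) : L * dot (- d - L^-1 *: v) (e - d) =
    L * enorm d ^+ 2 - L * dot d e - dot v e + dot v d.
  by rewrite enorm_sqr !dotE; field; rewrite gt_eqF.
by rewrite E; lra.
Qed.

Lemma pg_step_first x u w : pg_step x u -> (g w < +oo)%E ->
  F u <= phi x + fine (g w) + dot (grad phi x) (w - x)
         + L / 2 * enorm (w - x) ^+ 2.
Proof.
move=> pu gw; apply: le_trans (pg_step_le pu gw) _.
have := dot_ge0 ((u - x) - (w - x)).
move: (u - x) (w - x) => d e.
rewrite !dotE (dotC e d) -!enorm_sqr => /(mulr_ge0 (ltW L0)); lra.
Qed.

Lemma pg_step_decrease x u : pg_step x u -> (g x < +oo)%E ->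
  F u <= F x - L / 2 * enorm (u - x) ^+ 2.
Proof.
move=> pu gx; apply: le_trans (pg_step_le pu gx) _.
by rewrite subrr -(scale0r 0) !dotZr !mul0r mulr0 !addr0.
Qed.

(** The optimality condition of the step exhibits an explicit subgradient of g at
    u, namely L (x - u) - grad phi (x). *)
Lemma pg_step_stationarity x u : pg_step x u -> (g u < +oo)%E ->
  (dist_to (- grad phi u)%R (subdiff g u) <= (2 * L * enorm (u - x))%:E)%E.
Proof.
move=> pu gu; apply: le_trans (dist_to_le _ (prox_subdiff iL0 pu gu)) _.
rewrite lee_fin div1r invrK.
have -> : - grad phi u - L *: (x - L^-1 *: grad phi x - u) =
    (grad phi x - grad phi u) + L *: (u - x).
  rewrite !scalerBr scalerA divff ?gt_eqF// scale1r.
  by apply/rowP => i; rewrite !mxE; ring.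
apply: le_trans (enormD _ _) _; rewrite enormZ gtr0_norm//.
by have := lipphi x u; rewrite (enormBC x); lra.
Qed.

(** By [pg_step_stationarity] the step is longer than theta / (2 L); insert this in
    [pg_step_decrease]. *)
Lemma pg_step_charge x u theta : pg_step x u -> (g x < +oo)%E -> 0 <= theta ->
  ~ (dist_to (- grad phi u)%R (subdiff g u) <= theta%:E)%E ->
  F u + theta ^+ 2 / (8 * L) <= F x.
Proof.
move=> pu gx th0 /negP; rewrite -ltNge => far.
have := lt_le_trans far (pg_step_stationarity pu (prox_dom pu gx)).
rewrite lte_fin => {}far; have := pg_step_decrease pu gx.
suff : theta ^+ 2 / (8 * L) <= L / 2 * enorm (u - x) ^+ 2 by lra.
rewrite ler_pdivrMr; last by rewrite mulr_gt0.
have : theta ^+ 2 <= (2 * L * enorm (u - x)) ^+ 2.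
  apply: lerXn2r; rewrite ?nnegrE//; last exact: ltW.
  exact: le_trans th0 (ltW far).
by rewrite !exprMn; lra.
Qed.

Lemma pg_sequence (u : nat -> 'rV[R]_n) t theta delta :
  (g (u 0%N) < +oo)%E -> 0 <= theta -> delta <= theta ^+ 2 / (8 * L) ->
  (forall s, (s < t)%N -> pg_step (u s) (u s.+1)) ->
  (forall s, (s < t)%N ->
     ~ (dist_to (- grad phi (u s.+1))%R (subdiff g (u s.+1)) <= theta%:E)%E) ->
  (g (u t) < +oo)%E /\ F (u t) + delta * t%:R <= F (u 0%N).
Proof.
move=> g0 th0 dth; elim: t => [|t IH] step far; first by rewrite mulr0 addr0.
have [gt le] := IH (fun s st => step s (ltnW st)) (fun s st => far s (ltnW st)).
have st := step t (ltnSn t).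
split; first exact: prox_dom st gt.
have := pg_step_charge st gt th0 (far t (ltnSn t)).
by rewrite -[t.+1%:R]natr1 mulrDr mulr1; lra.
Qed.

End Step.
End Prox.

(** * The augmented Lagrangian method *)

Lemma enorm_box_proj (R : realType) m (b : R) (y : 'rV[R]_m) : 0 < b ->
  enorm (box_proj b y) <= enorm (const_mx b : 'rV[R]_m).
Proof.
move=> b0; rewrite ler_sqrt ?dot_ge0//; apply: ler_sum => i _.
rewrite !mxE; set e := Num.max _ _.
have eb : e <= b by rewrite ge_max ge_min lexx andbT; lra.
have be : - b <= e by rewrite le_max lexx.
by nra.
Qed.

Section Run.
Context {R : realType} {n m : nat} (P : problem R n m).
Variables (K : constants R) (I : inputs R n m) (kappa : R).
Hypotheses (hP : standing_problem P) (hK : smooth_bounded P K).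
Hypotheses (hI : valid_inputs I) (hnu : 0 < nu K) (hkappa : 0 < kappa).

(** Constants of the complexity bound.  They depend on the problem and on the
    inputs, but not on the run: [ybar] and [cbig], which do, are replaced by the
    upper bounds [mult_bound] and [residual_bound]. *)
Definition mult_bound : R :=
  enorm (y1 I) + enorm (const_mx (ymax I) : 'rV[R]_m).

Definition residual_const : R :=
  (lamf K + lamJ K * mult_bound + 1 / beta1 I) / nu K.

Definition residual_bound : R :=
  Num.max (enorm (pc P (x1 I))) (residual_const / beta1 I).

(** The penalty stays below [pen_bound / eps]: it starts at [beta1], and it is never
    raised from a value above (2 * residual_const + 2) / eps. *)
Definition pen_bound : R := beta1 I + gam I * (2 * residual_const + 2).

(** Upper bound on L_k when the penalty is beta; it is affine in beta, which makes
    L_k = O(1 / eps). *)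
Definition lip_bound (beta : R) : R :=
  Lf K + mult_bound * LJ K + beta * (LJ K * residual_bound + lamJ K * Lc K).

(** [tol_const * eps] bounds from below both the tolerances of the subproblems and
    eps / 2. *)
Definition tol_const : R := Num.min (1 / pen_bound) (Num.min kappa (1 / 2)).

Definition decrease_const : R := tol_const ^+ 2 / (8 * (1 + lip_bound pen_bound)).

Let b1_gt0 : 0 < beta1 I. Proof. by case: hI. Qed.
Let gam_gt1 : 1 < gam I. Proof. by case: hI. Qed.
Let tau_gt0 : 0 < tau I. Proof. by case: hI => _ _ _ /andP[]. Qed.
Let tau_lt1 : tau I < 1. Proof. by case: hI => _ _ _ /andP[]. Qed.
Let Lf0 : 0 <= Lf K. Proof. by case: hK => -[]. Qed.
Let LJ0 : 0 <= LJ K. Proof. by case: hK => -[]. Qed.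
Let Lc0 : 0 <= Lc K. Proof. by case: hK => -[]. Qed.
Let lamf0 : 0 <= lamf K. Proof. by case: hK => -[]. Qed.
Let lamJ0 : 0 <= lamJ K. Proof. by case: hK => -[]. Qed.
Let dpf x : differentiable (pf P) x. Proof. by case: hP => -[]. Qed.
Let dpc x : differentiable (pc P) x. Proof. by case: hP => _ []. Qed.
Let gconv : econvex (pg P). Proof. by case: hP. Qed.
Let gprop x : (-oo < pg P x)%E. Proof. by case: hP. Qed.

Let Y0 : 0 <= mult_bound. Proof. by rewrite addr_ge0 ?enorm_ge0. Qed.

Let D0 : 0 <= residual_const.
Proof.
apply: divr_ge0; last exact: ltW.
by rewrite !addr_ge0 ?mulr_ge0 ?invr_ge0 ?(ltW b1_gt0).
Qed.

Let C0 : 0 <= residual_bound.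
Proof. by rewrite le_max enorm_ge0. Qed.

Let pen_bound_gt0 : 0 < pen_bound.
Proof.
apply: addr_gt0 => //; apply: mulr_gt0; first exact: lt_trans gam_gt1.
by have := D0; lra.
Qed.

Let lip_slope_ge0 : 0 <= LJ K * residual_bound + lamJ K * Lc K.
Proof. by rewrite addr_ge0 ?mulr_ge0. Qed.

Let tol_const_gt0 : 0 < tol_const.
Proof. by rewrite !lt_min hkappa !divr_gt0. Qed.

Let lip_bound_ge0 : 0 <= lip_bound pen_bound.
Proof. by rewrite !addr_ge0 ?mulr_ge0// ltW. Qed.

Let decrease_const_gt0 : 0 < decrease_const.
Proof. by rewrite divr_gt0 ?exprn_gt0 ?mulr_gt0 ?ltr_pwDl. Qed.

Let gam_gt0 : 0 < gam I. Proof. exact: lt_trans gam_gt1. Qed.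

Let pen_growth_gt0 : 0 < gam I * (2 * residual_const + 2).
Proof. by rewrite mulr_gt0//; have := D0; lra. Qed.

(** A point where g is finite, to which the first step is compared. *)
Variable w0 : 'rV[R]_n.
Hypothesis hw : (pg P w0 < +oo)%E.
Hypothesis hwx : (pg P (x1 I) < +oo)%E -> w0 = x1 I.

Variables (eps : R) (eta' : nat -> R) (r : trace R n m).
Hypothesis heps : 0 < eps < 1.
Hypothesis hrun : is_run P K I eps eta' r.
Hypothesis hreg : regularity P K eps eta' r.
Hypothesis hlip : Lk_lipschitz P K I eps eta' r.
Hypothesis heta : forall k, executed P eps eta' r k -> kappa * eps <= eta' k.

Let e0 : 0 < eps. Proof. by case/andP: heps. Qed.
Let e1 : eps < 1. Proof. by case/andP: heps. Qed.

Local Notation ex := (executed P eps eta' r).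
Local Notation iters := (inner_iters P eta' r).
Local Notation res k := (enorm (pc P (outer r k))).
Local Notation aug k := (aug_lagrangian P (pen r k) (mult r k)).
Local Notation lip k := (Lk P K I eps eta' r k).

Lemma executed1 : ex 1.
Proof. by split=> // j /andP[j1]; rewrite ltnNge j1. Qed.

Lemma executed_le k j : ex k -> (1 <= j <= k)%N -> ex j.
Proof.
move=> [_ h] /andP[j1 jk]; split=> // i /andP[i1 ij].
by apply: h; rewrite i1 (leq_trans ij).
Qed.

Lemma executedW k : ex k.+1 -> (1 <= k)%N ->
  [/\ ex k, exists t, iters k t & ~ quits P eps r k].
Proof.
move=> exk k1; have [] := exk.2 k; first by rewrite k1 /=.
by move=> it nq; split=> //; apply: executed_le exk _; rewrite k1 leqnSn.
Qed.

Lemma executedS k t : ex k -> iters k t -> ~ quits P eps r k -> ex k.+1.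
Proof.
move=> [k1 h] it nq; split=> // j /andP[j1]; rewrite ltnS leq_eqVlt.
by move=> /predU1P[->|jk]; [split=> //; exists t|apply: h; rewrite j1].
Qed.

Lemma mult_le k : ex k -> enorm (mult r k) <= mult_bound.
Proof.
case: hrun => _ my1 _ _ hS; case: k => [[]//|[|k]] exk.
  by rewrite my1 lerDl enorm_ge0.
have [//|_ ->] := hS k.+1 _ exk.
apply: le_trans (enorm_box_proj _ _) _; first by case: hI.
by rewrite lerDr enorm_ge0.
Qed.

Lemma ybar_le : ybar P eps eta' r <= mult_bound.
Proof.
apply: ge_sup; first by exists (enorm (mult r 1)), 1%N => //; exact: executed1.
by move=> _ [k exk <-]; exact: mult_le.
Qed.

Lemma pen_step k : (1 <= k)%N -> ex k.+1 ->
  (pen r k.+1 = pen r k /\ res k.+1 <= tau I * res k) \/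
  pen r k.+1 = gam I * pen r k.
Proof.
case: hrun => _ _ _ _ hS k1 exk; have [->_] := hS k k1 exk.
by case: ifPn; [left|right].
Qed.

Lemma pen_ge k : ex k -> beta1 I <= pen r k.
Proof.
case: hrun => _ _ p1 _ _; elim: k => [[]//|[_ _|k IH exk]]; first by rewrite p1.
have [exk1 _ _] := executedW exk (ltn0Sn _).
have := IH exk1.
have [//|[-> _]|->] := @pen_step k.+1 _ exk => // h.
by apply: le_trans h _; rewrite ler_peMl ?ltW// (lt_le_trans b1_gt0 (IH exk1)).
Qed.

Lemma pen_gt0 k : ex k -> 0 < pen r k.
Proof. by move/pen_ge; exact: lt_le_trans. Qed.

Lemma Lk_le_lip_bound k : ex k -> lip k <= lip_bound (pen r k).
Proof.
move=> exk; have p0 := ltW (pen_gt0 exk).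
have yY := ybar_le; have cC : cbig P K I eps eta' r <= residual_bound.
  rewrite /cbig ge_max !le_max lexx /=; apply/orP; right.
  rewrite /residual_const -mulrA -invfM.
  rewrite ler_pM2r ?invr_gt0 ?mulr_gt0// lerD2r lerD2l.
  exact: ler_wpM2l.
rewrite /Lk /lip_bound mulrDr !mulrA addrA lerD2r; apply: lerD.
  by rewrite lerD2l; exact: ler_wpM2r.
by rewrite ler_wpM2l// mulr_ge0.
Qed.

(** So the stopping test of the subproblem bounds the stationarity term in the
    stopping test of the algorithm. *)
Lemma grad_aug_multiplier k u :
  grad (aug k) u = grad (lagrangian P (mult r k + pen r k *: pc P u)) u.
Proof. by rewrite grad_aug_lagrangian// grad_lagrangian. Qed.

Lemma iters_outer k t : ex k -> iters k t -> outer r k.+1 = inner r k t.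
Proof. by case: hrun => _ _ _ h _ /h[_ _]; apply. Qed.

(** The gradient of the augmented Lagrangian contains beta_k J^T c, the other terms
    being bounded, and it is within the tolerance of minus a subgradient v of g.
    So -J^T c is within O(1 / beta_k) of v / beta_k, and regularity turns this
    into a bound on |c|. *)
Lemma residual_le k t : ex k -> iters k t -> res k.+1 <= residual_const / pen r k.
Proof.
move=> exk it; have p0 := pen_gt0 exk; have pb := pen_ge exk.
rewrite /residual_const mulrAC ler_pdivlMr// mulrC ler_pdivlMr//.
apply/ler_addgt0Pr => e e_gt0.
have := hreg exk (ex_intro _ t it); have := it.1.
rewrite -(iters_outer exk it) /=; set x := outer r k.+1 => stop reg.
have : (dist_to (- grad (aug k) x)%R (subdiff (pg P) x) <
        (tol eta' r k + e)%:E)%E.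
  by apply: le_lt_trans stop _; rewrite lte_fin ltrDl.
move=> /ereal_inf_lt[_ [v gv <-]]; rewrite lte_fin => vlt.
have {}reg : nu K * enorm (pc P x) <=
    enorm (- (pc P x *m Jac (pc P) x) - (pen r k)^-1 *: v).
  rewrite -lee_fin; apply: le_trans reg _; apply: dist_to_le.
  by exists v.
have tl : tol eta' r k <= 1 / beta1 I.
  by rewrite ge_min !div1r lef_pV2 ?posrE ?pb.
have [_ _ [gf Jb] _] := hK.
have y_le : enorm (mult r k *m Jac (pc P) x) <= lamJ K * mult_bound.
  apply: le_trans (enorm_mulmx_tr_le_opnorm _ _) _.
  by apply: ler_pM; rewrite ?opnorm_ge0 ?enorm_ge0 ?Jb ?mult_le.
have E : pen r k *: (- (pc P x *m Jac (pc P) x) - (pen r k)^-1 *: v) =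
    (- grad (aug k) x - v) + (grad (pf P) x + mult r k *m Jac (pc P) x).
  rewrite grad_aug_lagrangian// scalerBr scalerA divff ?gt_eqF// scale1r.
  rewrite mulmxDl -scalemxAl scalerN.
  by apply/rowP => i; rewrite !mxE; ring.
have := ler_wpM2l (ltW p0) reg; rewrite -[X in _ <= X * _](gtr0_norm p0) -enormZ E.
have := enormD (- grad (aug k) x - v) (grad (pf P) x + mult r k *m Jac (pc P) x).
have := enormD (grad (pf P) x) (mult r k *m Jac (pc P) x).
have := gf x; lra.
Qed.

Lemma quits_suff k t : ex k -> iters k t ->
  tol eta' r k <= eps / 2 -> res k.+1 <= eps / 2 -> quits P eps r k.
Proof.
move=> exk it tl cl; have := it.1; rewrite -(iters_outer exk it).
rewrite /inner_stop grad_aug_multiplier => stop.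
rewrite /quits /eps_approximate (splitr eps) EFinD; apply: leeD.
  by apply: le_trans stop _; rewrite lee_fin.
by rewrite lee_fin.
Qed.

(** If the previous penalty were larger than (2 * residual_const + 2) / eps, the
    previous iteration would have quit, both terms being at most eps / 2. *)
Lemma pen_le k : ex k -> pen r k <= pen_bound / eps.
Proof.
case: k => [[]//|[|k]] exk; rewrite ler_pdivlMr//.
  case: hrun => _ _ -> _ _; apply: le_trans (_ : beta1 I <= _).
    by rewrite ler_piMr// ltW.
  by rewrite lerDl ltW.
have [exk1 [t it] nq] := executedW exk (ltn0Sn _).
have p0 := pen_gt0 exk1.
have small : pen r k.+1 * eps <= 2 * residual_const + 2.
  rewrite leNgt; apply/negP => big; apply: nq.
  apply: (quits_suff exk1 it).
    rewrite ge_min; apply/orP; left.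
    by rewrite ler_pdivrMr//; have := D0; lra.
  apply: le_trans (residual_le exk1 it) _.
  by rewrite ler_pdivrMr//; have := D0; lra.
have [//|[-> _]|->] := @pen_step k.+1 _ exk; rewrite /pen_bound.
  have : 0 <= (gam I - 1) * (2 * residual_const + 2).
    by apply: mulr_ge0; [rewrite subr_ge0 ltW|have := D0; lra].
  by have := b1_gt0; lra.
by rewrite -mulrA; have := ler_wpM2l (ltW gam_gt0) small; have := b1_gt0; lra.
Qed.

Lemma Lk_le k : ex k -> lip k <= (1 + lip_bound pen_bound) / eps.
Proof.
move=> exk; apply: le_trans (Lk_le_lip_bound exk) _.
rewrite ler_pdivlMr// /lip_bound.
have := pen_le exk; rewrite ler_pdivlMr// => /(ler_wpM2l lip_slope_ge0).
have := mulr_ge0 Y0 LJ0 => yl.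
have : Lf K * eps <= Lf K by rewrite ler_piMr// ltW.
have : mult_bound * LJ K * eps <= mult_bound * LJ K by rewrite ler_piMr// ltW.
lra.
Qed.

Lemma tol_ge k : ex k -> tol_const * eps <= tol eta' r k.
Proof.
move=> exk; rewrite le_min; apply/andP; split.
  rewrite ler_pdivlMr ?pen_gt0//.
  have := pen_le exk; rewrite ler_pdivlMr// => pl.
  have : tol_const <= 1 / pen_bound by rewrite ge_min lexx.
  rewrite ler_pdivlMr// => h; have := ler_wpM2l (ltW tol_const_gt0) pl; lra.
apply: le_trans (heta exk); rewrite ler_wpM2r ?(ltW e0)//.
by rewrite !ge_min lexx /= orbT.
Qed.

(** The decrease of the objective that a charged inner iteration guarantees. *)
Definition decrease : R := decrease_const * eps ^+ 3.

Lemma decrease_gt0 : 0 < decrease.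
Proof. by rewrite mulr_gt0 ?exprn_gt0. Qed.

Lemma decrease_le k : ex k ->
  decrease <= (tol_const * eps) ^+ 2 / (8 * lip k).
Proof.
move=> exk; have [l0 _] := hlip exk.
have := Lk_le exk; rewrite ler_pdivlMr// => ll.
have q0 : 0 < 1 + lip_bound pen_bound by rewrite ltr_pwDl.
rewrite ler_pdivlMr ?mulr_gt0// /decrease /decrease_const.
have -> : tol_const ^+ 2 / (8 * (1 + lip_bound pen_bound)) * eps ^+ 3 * (8 * lip k)
    = (tol_const * eps) ^+ 2 * (lip k * eps / (1 + lip_bound pen_bound)).
  by field; rewrite gt_eqF.
by rewrite ler_piMr ?sqr_ge0// ler_pdivrMr// mul1r.
Qed.

Definition merit k (x : 'rV[R]_n) : R := aug k x + fine (pg P x).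

Lemma inner_pg_step k t : ex k ->
  (forall s, (s <= t)%N -> ~ inner_stop P eta' r k (inner r k s)) ->
  pg_step (pg P) (aug k) (lip k) (inner r k t) (inner r k t.+1).
Proof. by case: hrun => _ _ _ h _ /h[_ + _]; apply. Qed.

Lemma aug_differentiable k x : differentiable (aug k) x.
Proof. exact: differentiable_aug_lagrangian. Qed.

Lemma not_stop_far k x : ex k -> ~ inner_stop P eta' r k x ->
  ~ (dist_to (- grad (aug k) x)%R (subdiff (pg P) x)
       <= (tol_const * eps)%:E)%E.
Proof.
by move=> exk ns le; apply: ns; apply: le_trans le _; rewrite lee_fin tol_ge.
Qed.

Let theta_ge0 : 0 <= tol_const * eps.
Proof. by rewrite mulr_ge0// ltW. Qed.

Lemma inner_chain k i t : ex k -> (pg P (inner r k i) < +oo)%E ->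
  (forall s, (s <= i + t)%N -> ~ inner_stop P eta' r k (inner r k s)) ->
  (pg P (inner r k (i + t)) < +oo)%E /\
  merit k (inner r k (i + t)) + decrease * t%:R <= merit k (inner r k i).
Proof.
move=> exk gi ns; have [l0 lp] := hlip exk.
pose u s := inner r k (i + s); rewrite -{3}(addn0 i).
apply: (pg_sequence (u := u) gconv gprop (aug_differentiable k) l0 lp _ theta_ge0
  (decrease_le exk)).
- by rewrite /u addn0.
- move=> s st; rewrite /u addnS; apply: inner_pg_step => // s' s's; apply: ns.
  by apply: leq_trans s's _; rewrite leq_add2l ltnW.
- by move=> s st; apply: not_stop_far => //; apply: ns; rewrite leq_add2l.
Qed.

Definition merit_low : R := fmin K + gmin K - mult_bound ^+ 2 / (2 * beta1 I).

(** Completing the square in beta / 2 |c|^2 - mult_bound |c| gives a lower bound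
    that is uniform in x. *)
Lemma merit_ge k x : ex k -> (pg P x < +oo)%E -> merit_low <= merit k x.
Proof.
move=> exk gx; have [_ _ _ [fm gm]] := hK; have := gm x; have := gprop x.
rewrite /merit /merit_low /aug_lagrangian; case: (pg P x) gx => //= G _ _.
rewrite lee_fin => gG; have := fm x; set c := pc P x.
have := cauchy_schwarz (- c) (mult r k); rewrite dotNl enormN.
have := ler_wpM2l (enorm_ge0 c) (mult_le exk).
have := ler_wpM2r (sqr_ge0 (enorm c)) (pen_ge exk).
have : 0 <= (beta1 I * enorm c - mult_bound) ^+ 2 / (2 * beta1 I).
  by rewrite divr_ge0 ?sqr_ge0 ?mulr_ge0// ltW.
have -> : (beta1 I * enorm c - mult_bound) ^+ 2 / (2 * beta1 I) =
   beta1 I / 2 * enorm c ^+ 2 - enorm c * mult_bound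
     + mult_bound ^+ 2 / (2 * beta1 I).
  by field; rewrite gt_eqF.
lra.
Qed.

(** A loop without end would decrease [merit], which is bounded below, by a fixed
    amount at each step.  The count starts at the first iterate, because g may be
    infinite at the starting point. *)
Lemma inner_terminates k : ex k -> exists t, iters k t.
Proof.
move=> exk; have [[t0 st0]|never] :=
    pselect (exists t, inner_stop P eta' r k (inner r k t)).
  have exb : exists t, `[< inner_stop P eta' r k (inner r k t) >].
    by exists t0; apply/asboolP.
  have [t /asboolP st tmin] := ex_minnP exb.
  exists t; split=> // s lts sts; have := tmin s.
  by rewrite leqNgt lts; move/(_ (introT (asboolP _) sts)).
have ns s : ~ inner_stop P eta' r k (inner r k s) by move=> h; apply: never; exists s.
have [w gw] : exists x, (pg P x < +oo)%E by case: hP.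
have g1 : (pg P (inner r k 1) < +oo)%E.
  by apply: prox_dom gw; [exact: gprop|apply: inner_pg_step => //].
have chain t := inner_chain (t := t) exk g1 (fun s _ => ns s).
have bnd t : merit_low + decrease * t%:R <= merit k (inner r k 1).
  by have [gt] := chain t; apply: le_trans; rewrite lerD2r merit_ge.
(* More steps than z would bring [merit] below [merit_low]. *)
pose z := (merit k (inner r k 1) - merit_low) / decrease.
have z0 : 0 <= z.
  by apply: divr_ge0; [rewrite subr_ge0 merit_ge|exact: ltW decrease_gt0].
have := archi_boundP z0; rewrite ltr_pdivrMr ?decrease_gt0//.
by have := bnd (Num.bound z); lra.
Qed.

(** All steps but the last end at a point that does not pass the stopping test, so
    they are charged.  The last one is paid for by [slack], unless its endpoint
    is not eps / 2-stationary, in which case it is charged as well. *)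
Lemma solve_tail k t i slack : ex k -> iters k t -> (i <= t)%N ->
  (pg P (inner r k i) < +oo)%E ->
  decrease <= slack \/
  (0 <= slack /\
   ~ (dist_to (- grad (aug k) (outer r k.+1))%R
        (subdiff (pg P) (outer r k.+1)) <= (eps / 2)%:E)%E) ->
  (pg P (outer r k.+1) < +oo)%E /\
  merit k (outer r k.+1) + decrease * (t - i)%:R
    <= merit k (inner r k i) + slack.
Proof.
move=> exk it ilt gi hs; rewrite (iters_outer exk it) in hs *.
have d0 := decrease_gt0.
have s0 : 0 <= slack by case: hs => [|[]//]; lra.
move: it ilt hs; case: (ltnP i t) => [|ti]; last first.
  move=> _ it _; have -> : t = i by apply/eqP; rewrite eqn_leq ti it.
  by rewrite subnn mulr0 addr0 lerDl.
case: t => // t; rewrite ltnS => ilt it _ hs.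
have ns s : (s <= t)%N -> ~ inner_stop P eta' r k (inner r k s).
  by move=> st; apply: it.2.
have [] := inner_chain (i := i) (t := t - i) exk gi.
  by rewrite subnKC.
rewrite subnKC// => gt le.
have stp := inner_pg_step exk ns; have [l0 lp] := hlip exk.
split; first exact: (prox_dom gprop stp gt).
rewrite subSn// -[(t - i).+1%:R]natr1 mulrDr mulr1.
case: hs => [ds|[_ far]].
  have := pg_step_decrease gconv gprop (aug_differentiable k) l0 lp stp gt.
  have : 0 <= lip k / 2 * enorm (inner r k t.+1 - inner r k t) ^+ 2.
    by rewrite mulr_ge0 ?sqr_ge0// divr_ge0// ltW.
  rewrite -/(merit k _) -/(merit k _); lra.
have far' : ~ (dist_to (- grad (aug k) (inner r k t.+1))%R
   (subdiff (pg P) (inner r k t.+1)) <= (tol_const * eps)%:E)%E.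
  move=> h; apply: far; apply: le_trans h _.
  have : tol_const <= 1 / 2 by rewrite !ge_min lexx !orbT.
  by rewrite lee_fin => /(ler_wpM2r (ltW e0)); lra.
have := pg_step_charge gconv gprop (aug_differentiable k) l0 lp stp gt theta_ge0 far'.
rewrite -/(merit k _) -/(merit k _); have := decrease_le exk; lra.
Qed.

Lemma inner0 k : ex k -> inner r k 0 = outer r k.
Proof. by case: hrun => _ _ _ h _ /h[]. Qed.

Lemma decrease_le_const : decrease <= decrease_const.
Proof.
by rewrite ler_piMr ?(ltW decrease_const_gt0)// exprn_ile1// ltW.
Qed.

Let dc_ge0 : 0 <= decrease_const. Proof. exact: ltW. Qed.

Let slack_ge0 k : 0 <= 2 * decrease_const * res k.
Proof. by apply: mulr_ge0 (enorm_ge0 _); apply: mulr_ge0. Qed.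

(** Since the algorithm does not quit, an endpoint that is eps / 2-stationary has
    |c| > eps / 2, so that a multiple of |c| pays for the last step. *)
Lemma solve_nonquit k t : ex k -> iters k t -> ~ quits P eps r k ->
  (pg P (outer r k) < +oo)%E ->
  (pg P (outer r k.+1) < +oo)%E /\
  merit k (outer r k.+1) + decrease * t%:R
    <= merit k (outer r k) + 2 * decrease_const * res k.+1.
Proof.
move=> exk it nq gk; rewrite -(subn0 t) -(inner0 exk).
have sl0 := slack_ge0 k.+1.
apply: solve_tail => //; first by rewrite inner0.
have [cl|cg] := leP (res k.+1) (eps / 2); [right; split=> // dl|left].
  apply: nq; rewrite /quits /eps_approximate (splitr eps) EFinD; apply: leeD.
    by rewrite -grad_aug_multiplier.
  by rewrite lee_fin.
have e3 : eps ^+ 3 <= eps by rewrite exprS ler_piMr ?exprn_ile1 ?(ltW e0) ?(ltW e1).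
have : eps ^+ 3 <= 2 * res k.+1 by lra.
by move/(ler_wpM2l dc_ge0); rewrite /decrease; lra.
Qed.

Lemma solve_quit k t : ex k -> iters k t -> (pg P (outer r k) < +oo)%E ->
  (pg P (outer r k.+1) < +oo)%E /\
  merit k (outer r k.+1) + decrease * t%:R
    <= merit k (outer r k) + decrease_const.
Proof.
move=> exk it gk; rewrite -(subn0 t) -(inner0 exk).
apply: solve_tail => //; first by rewrite inner0.
by left; exact: decrease_le_const.
Qed.

(** Bounds the objective of the first subproblem after one step, by
    [pg_step_first] with competitor w0. *)
Definition first_bound : R :=
  let phi := aug_lagrangian P (beta1 I) (y1 I) in
  phi (x1 I) + fine (pg P w0) + dot (grad phi (x1 I)) (w0 - x1 I)
    + lip_bound (beta1 I) / 2 * enorm (w0 - x1 I) ^+ 2.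

(** The first step is not charged, since g may be infinite at x1, and neither is
    the last one; hence the term 2 * decrease_const. *)
Lemma solve_first t : iters 1 t ->
  (pg P (outer r 2) < +oo)%E /\
  merit 1 (outer r 2) + decrease * t%:R <= first_bound + 2 * decrease_const.
Proof.
move=> it; have exk := executed1; have [l0 lp] := hlip exk.
have dl := decrease_le_const; have d0 := decrease_gt0.
have [ox my pb _ _] := hrun.
have lb : lip_bound (beta1 I) >= 0.
  by apply: le_trans (ltW l0) _; rewrite -pb; exact: Lk_le_lip_bound.
have tail i h gi := solve_tail (i := i) exk it h gi (or_introl (lexx decrease)).
(* If x1 already passes the test, g is finite there and w0 = x1. *)
case: t it tail => [|t] it tail.
  have g1 : (pg P (x1 I) < +oo)%E.
    have := it.1; rewrite inner0// ox /inner_stop => stop.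
    rewrite ltNge; apply/negP => gy; move: stop; rewrite /dist_to.
    rewrite (_ : subdiff _ _ = set0); last first.
      by apply/seteqP; split=> // v []; rewrite ltNge gy.
    by rewrite image_set0 ereal_inf0.
  have [] := tail 0%N (leqnn _); first by rewrite inner0// ox.
  rewrite subnn inner0// ox => g2 le; split=> //; apply: le_trans le _.
  rewrite /first_bound (hwx g1) subrr enorm0 expr0n/= mulr0 /merit my pb.
  rewrite -(scale0r 0) dotZr mul0r !addr0; lra.
have stp : pg_step (pg P) (aug 1) (lip 1) (inner r 1 0) (inner r 1 1).
  by apply: inner_pg_step => // s s0; apply: it.2; apply: leq_ltn_trans s0 _.
have g1 := prox_dom gprop stp hw.
have [//|g2 le] := tail 1%N _ g1; split=> //.
have := pg_step_first gconv gprop (aug_differentiable 1) l0 lp stp hw.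
rewrite -/(merit 1 _) inner0// ox my pb => h.
have : lip 1 / 2 * enorm (w0 - x1 I) ^+ 2
       <= lip_bound (beta1 I) / 2 * enorm (w0 - x1 I) ^+ 2.
  rewrite ler_wpM2r ?sqr_ge0// ler_pM2r ?invr_gt0//.
  by rewrite -pb; exact: Lk_le_lip_bound.
move: le; rewrite subn1 /= -[t.+1%:R]natr1 mulrDr mulr1 /first_bound; lra.
Qed.

(** Up to an additive constant, the number of times the penalty was raised. *)
Definition level k : R := ln (pen r k) / ln (gam I).

Let lngam_gt0 : 0 < ln (gam I). Proof. exact: ln_gt0. Qed.

Lemma level_step k : (1 <= k)%N -> ex k.+1 ->
  (pen r k.+1 = pen r k /\ level k.+1 = level k /\ res k.+1 <= tau I * res k) \/
  (pen r k.+1 = gam I * pen r k /\ level k.+1 = level k + 1).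
Proof.
move=> k1 exk; have [exk1 _ _] := executedW exk k1.
have [[E c]|E] := pen_step k1 exk; [left|right]; rewrite /level E //.
by rewrite lnM ?posrE ?pen_gt0// mulrDl divff ?gt_eqF// addrC.
Qed.

Lemma residual_le_bound k : ex k -> res k <= residual_bound.
Proof.
case: k => [[]//|[|k]] exk; rewrite le_max.
  by case: hrun => -> _ _ _ _; rewrite lexx.
have [exk1 [t it] _] := executedW exk (ltn0Sn _).
apply/orP; right; apply: le_trans (residual_le exk1 it) _.
by rewrite ler_wpM2l// lef_pV2 ?posrE ?pen_gt0// pen_ge.
Qed.

(** Summed over k, this bounds the sum of the |c(x_k)| by the number of penalty
    increases: either |c| has contracted by the factor tau, which gives the first
    term, or the level has gone up by one and pays for [residual_bound]. *)
Lemma residual_contract k : (1 <= k)%N -> ex k.+1 ->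
  res k.+1 <= tau I / (1 - tau I) * (res k - res k.+1)
              + residual_bound / (1 - tau I) * (level k.+1 - level k).
Proof.
move=> k1 exk; have t1 : 0 < 1 - tau I by rewrite subr_gt0.
rewrite (mulrAC (tau I)) (mulrAC residual_bound) -mulrDl ler_pdivlMr//.
have c0 := enorm_ge0 (pc P (outer r k)); have ck := residual_le_bound exk.
have := mulr_ge0 (ltW tau_gt0) c0.
by have [[_ [-> h]]|[_ ->]] := level_step k1 exk; lra.
Qed.

(** The cost of raising the penalty from beta to gamma beta: the term
    (gamma - 1) beta / 2 |c|^2 stays bounded because |c| <= residual_const / beta. *)
Definition jump_cost : R := (gam I - 1) / 2 * (residual_const ^+ 2 / beta1 I).

Lemma merit_next k : (1 <= k)%N -> ex k.+1 ->
  merit k.+1 (outer r k.+1) <= merit k (outer r k.+1)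
    + 2 * mult_bound * res k.+1 + jump_cost * (level k.+1 - level k).
Proof.
move=> k1 exk; have [exk1 [t it] _] := executedW exk k1.
have p0 := pen_gt0 exk1; have pb := pen_ge exk1.
have := residual_le exk1 it; rewrite ler_pdivlMr//.
rewrite /merit /aug_lagrangian; set c := pc P (outer r k.+1); move=> cD.
have c0 := enorm_ge0 c.
have := cauchy_schwarz c (mult r k.+1 - mult r k); rewrite dotDr dotNr.
have := enormB (mult r k.+1) (mult r k).
have := mult_le exk; have := mult_le exk1 => h1 h2 h3 h4.
have {}h4 : dot c (mult r k.+1) - dot c (mult r k) <= 2 * mult_bound * enorm c.
  apply: le_trans h4 _; rewrite mulrC ler_wpM2r//; lra.
suff : (pen r k.+1 - pen r k) / 2 * enorm c ^+ 2
       <= jump_cost * (level k.+1 - level k) by lra.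
have [[-> [-> _]]|[-> ->]] := level_step k1 exk; first by rewrite !subrr !mul0r mulr0.
have E : (gam I * pen r k - pen r k) / 2 * enorm c ^+ 2 =
   (gam I - 1) / 2 * (enorm c * pen r k * enorm c) by ring.
rewrite E [level k + 1]addrC addrK mulr1 ler_wpM2l//; first by
  rewrite divr_ge0// subr_ge0 ltW.
rewrite expr2 -[leRHS]mulrA; apply: ler_pM => //; first exact: mulr_ge0 (ltW p0).
by rewrite ler_pdivlMr//; apply: le_trans cD; rewrite ler_wpM2l.
Qed.

(** A unit of |c(x_(k+1))| has to pay for the change of multiplier and for the last
    inner step; a unit of level, for |c| being reset and for the change of
    penalty. *)
Definition residual_weight : R := 2 * mult_bound + 2 * decrease_const.

Definition level_weight : R :=
  residual_weight * (residual_bound / (1 - tau I)) + jump_cost.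

Let A_ge0 : 0 <= residual_weight.
Proof. by apply: addr_ge0; apply: mulr_ge0. Qed.

Let B_ge0 : 0 <= level_weight.
Proof.
have t1 : 0 <= 1 - tau I by rewrite subr_ge0 ltW.
apply: addr_ge0; first by apply: mulr_ge0 => //; apply: divr_ge0.
apply: mulr_ge0; apply: divr_ge0 => //; rewrite ?sqr_ge0 ?subr_ge0//; exact: ltW.
Qed.

Definition potential k : R := merit k (outer r k)
  + residual_weight * (tau I / (1 - tau I) * res k) - level_weight * level k.

(** [V] is the objective at the start of the k-th subproblem, or, for the first
    subproblem, the bound that replaces it. *)
Lemma potential_step k t V : (1 <= k)%N -> ex k.+1 ->
  merit k (outer r k.+1) + decrease * t%:R <= V + 2 * decrease_const * res k.+1 ->
  potential k.+1 + decrease * t%:R <=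
  V + residual_weight * (tau I / (1 - tau I) * res k) - level_weight * level k.
Proof.
move=> k1 exk h; have := merit_next k1 exk.
have := ler_wpM2l A_ge0 (residual_contract k1 exk).
rewrite /potential /level_weight.
have -> : residual_weight * res k.+1 =
   2 * mult_bound * res k.+1 + 2 * decrease_const * res k.+1 by rewrite -mulrDl.
lra.
Qed.

Definition start_bound : R := first_bound + 2 * decrease_const
  + residual_weight * (tau I / (1 - tau I) * enorm (pc P (x1 I)))
  - level_weight * (ln (beta1 I) / ln (gam I)).

Lemma potential_sum (T : nat -> nat) k : (1 <= k)%N -> ex k.+1 ->
  (forall j, (1 <= j <= k)%N -> iters j (T j)) ->
  (pg P (outer r k.+1) < +oo)%E /\
  potential k.+1 + decrease * (\sum_(1 <= j < k.+1) T j)%N%:R <= start_bound.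
Proof.
elim: k => // k IH _ exk hT; have [exk1 _ nq] := executedW exk (ltn0Sn _).
have itk : iters k.+1 (T k.+1) by apply: hT; rewrite /= leqnn.
case: k => [|k] in IH exk hT exk1 nq itk *.
  have [g2 le] := solve_first itk; split=> //.
  have [ox _ pb _ _] := hrun.
  rewrite big_nat1 /start_bound -pb -ox -/(level 1).
  apply: potential_step => //; apply: le_trans le _.
  by rewrite lerDl.
have [||gk le] := IH _ exk1 => //.
  by move=> j /andP[j1 jk]; apply: hT; rewrite j1 leqW.
have [gk1 le1] := solve_nonquit exk1 itk nq gk; split=> //.
have := potential_step (isT : (1 <= k.+2)%N) exk le1; rewrite -/(potential _).
rewrite big_nat_recr//= natrD mulrDr; lra.
Qed.

(** The k-th outer iteration is treated apart from [potential_sum]: the algorithm may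
    quit there, and then its last inner step is paid for by a constant. *)
Lemma total_decrease (T : nat -> nat) k : ex k ->
  (forall j, (1 <= j <= k)%N -> iters j (T j)) ->
  decrease * (\sum_(1 <= j < k.+1) T j)%N%:R
    <= start_bound + decrease_const - merit_low + level_weight * level k.
Proof.
case: k => [[]//|k] exk hT.
have itk : iters k.+1 (T k.+1) by apply: hT; rewrite /= leqnn.
have dc0 := decrease_const_gt0.
have At0 (c : 'rV[R]_m) : 0 <= residual_weight * (tau I / (1 - tau I) * enorm c).
  apply: mulr_ge0 => //; apply: mulr_ge0 (enorm_ge0 _).
  by apply: divr_ge0; rewrite ?subr_ge0 ltW.
case: k => [|k] in exk hT itk *.
  have [g2 le] := solve_first itk; have [ox _ pb _ _] := hrun.
  rewrite big_nat1 /start_bound -pb -/(level 1).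
  have := merit_ge exk g2; have := At0 (pc P (x1 I)); lra.
have [|gk le] := potential_sum (T := T) (isT : (1 <= k.+1)%N) exk.
  by move=> j /andP[j1 jk]; apply: hT; rewrite j1 leqW.
have [gk1 le1] := solve_quit exk itk gk.
have := merit_ge exk gk1; have := At0 (pc P (outer r k.+2)).
rewrite big_nat_recr//= natrD mulrDr; move: le; rewrite /potential; lra.
Qed.

Lemma level_le k : ex k -> level k <= (ln pen_bound + ln eps^-1) / ln (gam I).
Proof.
move=> exk; rewrite ler_pM2r ?invr_gt0//.
by rewrite -lnM ?posrE ?invr_gt0// ler_ln ?posrE ?pen_gt0 ?divr_gt0// pen_le.
Qed.

(** Otherwise |c| would exceed eps / 2 at all iterations from N on, whereas
    [residual_contract] bounds the sum of these values, the level being bounded. *)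
Lemma outer_terminates :
  (exists N : nat, (1 <= N)%N /\
     forall k, (N <= k)%N -> ex k -> tol eta' r k <= eps / 2) ->
  exists k, ex k /\ quits P eps r k.
Proof.
move=> [N [N1 hN]]; apply: contrapT => never.
have exk k : (1 <= k)%N -> ex k.
  elim: k => // -[_ _|k IH _]; first exact: executed1.
  have exk := IH isT; have [t it] := inner_terminates exk.
  by apply: (executedS exk it) => q; apply: never; exists k.+1.
pose rho := tau I / (1 - tau I).
pose S := residual_bound / (1 - tau I).
have t1 : 0 < 1 - tau I by rewrite subr_gt0.
have rho0 : 0 <= rho by rewrite divr_ge0// ltW.
have S0 : 0 <= S by rewrite divr_ge0// ltW.
have acc j : j%:R * (eps / 2) <=
    rho * (res N - res (N + j)) + S * (level (N + j) - level N).
  elim: j => [|j IH]; first by rewrite addn0 !subrr !mulr0 mul0r addr0.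
  have k1 : (1 <= N + j)%N by rewrite addn_gt0 N1.
  have exk1 := exk _ k1; have [t it] := inner_terminates exk1.
  have far : eps / 2 < res (N + j).+1.
    rewrite ltNge; apply/negP => small; apply: never; exists (N + j)%N; split=> //.
    by apply: (quits_suff exk1 it) => //; apply: hN => //; exact: leq_addr.
  have := residual_contract k1 (exk _ (leqW k1)).
  rewrite addnS -[j.+1%:R]natr1 -/rho -/S; lra.
pose M := rho * res N + S * ((ln pen_bound + ln eps^-1) / ln (gam I) - level N).
have bnd j : j%:R * (eps / 2) <= M.
  apply: le_trans (acc j) _; apply: lerD.
    by rewrite ler_wpM2l// gerBl enorm_ge0.
  rewrite ler_wpM2l// lerD2r; apply: level_le; apply: exk.
  by rewrite addn_gt0 N1.
have e20 : 0 < eps / 2 by rewrite divr_gt0.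
have M0 : 0 <= M / (eps / 2).
  by rewrite divr_ge0 ?(ltW e20)//; have := bnd 0%N; rewrite mul0r.
have := archi_boundP M0; rewrite ltr_pdivrMr//.
by rewrite ltNge bnd.
Qed.

Definition complexity_const : R :=
  (`|start_bound + decrease_const - merit_low
     + level_weight * (ln pen_bound / ln (gam I))|
   + level_weight / ln (gam I)) / decrease_const.

Lemma total_iterations_le (T : nat -> nat) k : ex k ->
  (forall j, (1 <= j <= k)%N -> iters j (T j)) ->
  (\sum_(1 <= j < k.+1) T j)%N%:R
    <= complexity_const * eps ^- 3 * (1 + ln eps^-1).
Proof.
move=> exk /(total_decrease exk); set S := _%:R => le.
rewrite /complexity_const; set W := start_bound + _ - _ + _.
have -> : (`|W| + level_weight / ln (gam I)) / decrease_const * eps ^- 3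
    * (1 + ln eps^-1) =
  (`|W| + level_weight / ln (gam I)) * (1 + ln eps^-1) / decrease.
  by rewrite /decrease; field; rewrite !gt_eqF.
rewrite ler_pdivlMr ?decrease_gt0// mulrC.
have l0 : 0 <= ln eps^-1 by rewrite ln_ge0// invf_ge1// ltW.
have v0 : 0 <= level_weight / ln (gam I) by apply: divr_ge0 => //; exact: ltW.
have := ler_wpM2l B_ge0 (level_le exk).
have := mulr_ge0 (normr_ge0 W) l0; have := ler_norm W.
have : W = start_bound + decrease_const - merit_low
     + level_weight * (ln pen_bound / ln (gam I)) by [].
lra.
Qed.

End Run.

Theorem theorem5p8 (R : realType) (n m : nat) (P : problem R n m)
    (K : constants R) (I : inputs R n m) (kappa : R)
    (hP : standing_problem P) (hK : smooth_bounded P K)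
    (hI : valid_inputs I) (hnu : 0 < nu K) (hkappa : 0 < kappa) :
  exists (C : R) (p : nat),
    forall (eps : R) (eta' : nat -> R) (r : trace R n m),
      0 < eps < 1 ->
      tolerance_sequence eta' ->
      is_run P K I eps eta' r ->
      regularity P K eps eta' r ->
      Lk_lipschitz P K I eps eta' r ->
      (exists N : nat, (1 <= N)%N /\
         forall k, (N <= k)%N -> executed P eps eta' r k ->
           tol eta' r k <= eps / 2) ->
      (forall k, executed P eps eta' r k -> kappa * eps <= eta' k) ->
      exists (kend : nat) (T : nat -> nat),
        [/\ executed P eps eta' r kend,
            (forall k, (1 <= k <= kend)%N -> inner_iters P eta' r k (T k)),
            eps_approximate P eps (outer r kend.+1) (yhat P r kend) &
            (\sum_(1 <= k < kend.+1) T k)%N%:R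
              <= C * eps ^- 3 * (1 + ln (eps^-1)) ^+ p].
Proof.
(* The reference point must be x1 itself when g is finite there. *)
have [w0 [hw hwx]] : exists w0, (pg P w0 < +oo)%E /\
    ((pg P (x1 I) < +oo)%E -> w0 = x1 I).
  have [gx1|gx1] := pselect (pg P (x1 I) < +oo)%E; first by exists (x1 I).
  by have [_ _ _ _ [w gw]] := hP; exists w.
exists (complexity_const P K I kappa w0), 1%N.
move=> eps eta' r heps _ hrun hreg hlip hN heta.
have [kend [exk q]] :=
  outer_terminates hP hK hI hnu hkappa heps hrun hreg hlip heta hN.
have /choice[T hT] : forall k, exists t, executed P eps eta' r k ->
    inner_iters P eta' r k t.
  move=> k; have [ek|] := pselect (executed P eps eta' r k); last by exists 0%N.
  have [t it] := inner_terminates hP hK hI hnu hkappa heps hrun hreg hlip heta ek.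
  by exists t.
have hT' j : (1 <= j <= kend)%N -> inner_iters P eta' r j (T j).
  by move=> jk; apply: hT; exact: executed_le exk jk.
exists kend, T; split=> //.
rewrite expr1.
exact: (total_iterations_le hP hK hI hnu hkappa hw hwx heps hrun hreg hlip heta).
Qed.
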